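(* Let $\mu_3^0$ be the three-dimensional complex associative algebra with basis $\{e_1,e_2,e_3\}$ and non-zero products $e_1e_1=e_2$, $e_1e_2=e_2e_1=e_3$. Any three-dimensional complex anti-dendriform algebra associated to $\mu_3^0$ is isomorphic to one of the following two non-isomorphic algebras (with basis $\{e_1,e_2,e_3\}$, omitted products being zero): $AD_3^1:\ e_1\vartriangleright e_1=\frac12 e_2,\ e_1\vartriangleleft e_1=\frac12 e_2,\ e_1\vartriangleright e_2=e_2\vartriangleleft e_1=2e_3,\ e_2\vartriangleright e_1=e_1\vartriangleleft e_2=-e_3;$ $AD_3^2:\ e_1\vartriangleright e_1=\frac12 e_2+e_3,\ e_1\vartriangleleft e_1=\frac12 e_2-e_3,\ e_1\vartriangleright e_2=e_2\vartriangleleft e_1=2e_3,\ e_2\vartriangleright e_1=e_1\vartriangleleft e_2=-e_3.$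
   Context: An anti-dendriform algebra is a vector space $A$ with two bilinear operations $\vartriangleright,\vartriangleleft: A\otimes A\to A$ such that, writing $x\cdot y=x\vartriangleright y+x\vartriangleleft y$, for all $x,y,z\in A$: $x\vartriangleright(y\vartriangleright z)=-(x\cdot y)\vartriangleright z=-x\vartriangleleft(y\cdot z)=(x\vartriangleleft y)\vartriangleleft z$ and $(x\vartriangleright y)\vartriangleleft z=x\vartriangleright(y\vartriangleleft z)$. Then $(A,\cdot)$ is an associative algebra, called the associated associative algebra of $(A,\vartriangleright,\vartriangleleft)$. An anti-dendriform algebra is associated to an associative algebra $B$ if its associated associative algebra is (isomorphic to) $B$. Isomorphisms of anti-dendriform algebras are linear bijections preserving both operations $\vartriangleright$ and $\vartriangleleft$. *)

(* Defs.v *)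
From HB Require Import structures.
From mathcomp Require Import all_boot all_order all_algebra.
From mathcomp Require Import sesquilinear.
From mathcomp Require Import ring.

Set Implicit Arguments.
Unset Strict Implicit.
Unset Printing Implicit Defensive.

Import GRing.Theory.
Local Open Scope ring_scope.

(* Associative algebras are not assumed unital (mu_3^0 is nilpotent), so the
   library's algType does not apply. *)
Record assocAlg (K : fieldType) (V : lmodType K) := AssocAlg {
  amul : {bilinear V -> V -> V};
  amulA : associative amul
}.

Definition assoc_iso (K : fieldType) (V W : lmodType K)
    (A : assocAlg V) (B : assocAlg W) : Prop :=
  exists f : {linear V -> W},
    bijective f /\ forall x y, f (amul A x y) = amul B (f x) (f y).

(* r and l stand for the operations |> and <|. *)
Definition antidendriform_axiom (K : fieldType) (V : lmodType K)
    (r l : V -> V -> V) : Prop :=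
  let m x y := r x y + l x y in
  forall x y z,
    [/\ r x (r y z) = - r (m x y) z,
        - r (m x y) z = - l x (m y z),
        - l x (m y z) = l (l x y) z
      & l (r x y) z = r x (l y z)].

Record antiDendriform (K : fieldType) (V : lmodType K) := AntiDendriform {
  adr : {bilinear V -> V -> V};
  adl : {bilinear V -> V -> V};
  adP : antidendriform_axiom adr adl
}.

Definition antidendriform_iso (K : fieldType) (V W : lmodType K)
    (A : antiDendriform V) (B : antiDendriform W) : Prop :=
  exists f : {linear V -> W},
    [/\ bijective f,
        forall x y, f (adr A x y) = adr B (f x) (f y)
      & forall x y, f (adl A x y) = adl B (f x) (f y)].

Section AssociatedAlgebra.
Variables (K : fieldType) (V : lmodType K) (A : antiDendriform V).

Definition ad_mul (x y : V) : V := adr A x y + adl A x y.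

Fact ad_mul_bilinear : bilinear_for *:%R *:%R ad_mul.
Proof.
split=> u a x y; rewrite /ad_mul /=.
  by rewrite !linearPl scalerDr addrACA.
by rewrite !linearPr scalerDr addrACA.
Qed.

HB.instance Definition _ :=
  bilinear_isBilinear.Build K V V V *:%R *:%R ad_mul ad_mul_bilinear.

Fact ad_mulA : associative ad_mul.
Proof.
move=> x y z; rewrite /ad_mul.
have [h1 h2 h3 h4] := adP A x y z.
have hr : adr A (adr A x y + adl A x y) z = - adr A x (adr A y z).
  by rewrite h1 opprK.
have hl : adl A x (adr A y z + adl A y z) = - adr A x (adr A y z).
  by rewrite h1 h2 opprK.
rewrite hr hl (linearDr (adr A)) (linearDl (adl A)) h4 -h3 -h2 -h1.
by rewrite addrAC subrr add0r addrCA addNr addr0.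
Qed.

Definition associated_alg : assocAlg V := AssocAlg ad_mulA.

End AssociatedAlgebra.

Definition associated_to (K : fieldType) (V W : lmodType K)
    (A : antiDendriform V) (B : assocAlg W) : Prop :=
  assoc_iso (associated_alg A) B.

Section StructureConstants.
Variables (K : fieldType) (n : nat).

(* The bilinear operation on K^n determined by the products c i j of the
   i-th and j-th vectors of the canonical basis. *)
Definition table_mul (c : 'I_n -> 'I_n -> 'rV[K]_n) (x y : 'rV[K]_n) :
    'rV[K]_n :=
  \sum_i \sum_j (x 0 i * y 0 j) *: c i j.

Variable c : 'I_n -> 'I_n -> 'rV[K]_n.

Fact table_mul_bilinear : bilinear_for *:%R *:%R (table_mul c).
Proof.
split=> u a x y; rewrite /table_mul /=.
all: rewrite scaler_sumr -big_split; apply: eq_bigr => i _ /=.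
all: rewrite scaler_sumr -big_split; apply: eq_bigr => j _ /=.
all: rewrite !mxE scalerA -scalerDl; congr (_ *: _).
  by rewrite mulrDl mulrA.
by rewrite mulrDr mulrCA.
Qed.

HB.instance Definition _ :=
  bilinear_isBilinear.Build K 'rV[K]_n 'rV[K]_n 'rV[K]_n *:%R *:%R
    (table_mul c) table_mul_bilinear.

End StructureConstants.

Section DimensionThree.
Variable K : numFieldType.

Definition e1 : 'rV[K]_3 := delta_mx 0 (@Ordinal 3 0 isT).
Definition e2 : 'rV[K]_3 := delta_mx 0 (@Ordinal 3 1 isT).
Definition e3 : 'rV[K]_3 := delta_mx 0 (@Ordinal 3 2 isT).

(* 'I_3 starts at 0: the successors in the tables below recover the
   indices 1, 2, 3 of the basis vectors. *)
Definition mu30_table (i j : 'I_3) : 'rV[K]_3 :=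
  match i.+1, j.+1 with
  | 1, 1 => e2
  | 1, 2 => e3
  | 2, 1 => e3
  | _, _ => 0%R
  end%N.

Definition AD31_r_table (i j : 'I_3) : 'rV[K]_3 :=
  match i.+1, j.+1 with
  | 1, 1 => (2^-1 *: e2)%R
  | 1, 2 => (2 *: e3)%R
  | 2, 1 => (- e3)%R
  | _, _ => 0%R
  end%N.

Definition AD31_l_table (i j : 'I_3) : 'rV[K]_3 :=
  match i.+1, j.+1 with
  | 1, 1 => (2^-1 *: e2)%R
  | 2, 1 => (2 *: e3)%R
  | 1, 2 => (- e3)%R
  | _, _ => 0%R
  end%N.

Definition AD32_r_table (i j : 'I_3) : 'rV[K]_3 :=
  match i.+1, j.+1 with
  | 1, 1 => (2^-1 *: e2 + e3)%R
  | 1, 2 => (2 *: e3)%R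
  | 2, 1 => (- e3)%R
  | _, _ => 0%R
  end%N.

Definition AD32_l_table (i j : 'I_3) : 'rV[K]_3 :=
  match i.+1, j.+1 with
  | 1, 1 => (2^-1 *: e2 - e3)%R
  | 2, 1 => (2 *: e3)%R
  | 1, 2 => (- e3)%R
  | _, _ => 0%R
  end%N.


Let o0 := @Ordinal 3 0 isT.
Let o1 := @Ordinal 3 1 isT.
Let o2 := @Ordinal 3 2 isT.

Lemma row3P (u v : 'rV[K]_3) :
  u 0 o0 = v 0 o0 -> u 0 o1 = v 0 o1 -> u 0 o2 = v 0 o2 -> u = v.
Proof.
move=> h0 h1 h2; apply/rowP=> -[[|[|[|//]]] hi].
- by rewrite (_ : Ordinal hi = o0) //; apply: val_inj.
- by rewrite (_ : Ordinal hi = o1) //; apply: val_inj.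
- by rewrite (_ : Ordinal hi = o2) //; apply: val_inj.
Qed.

Lemma table_mul3E c (x y : 'rV[K]_3) k : table_mul c x y 0 k =
  x 0 o0 * y 0 o0 * c o0 o0 0 k + x 0 o0 * y 0 o1 * c o0 o1 0 k +
  x 0 o0 * y 0 o2 * c o0 o2 0 k + x 0 o1 * y 0 o0 * c o1 o0 0 k +
  x 0 o1 * y 0 o1 * c o1 o1 0 k + x 0 o1 * y 0 o2 * c o1 o2 0 k +
  x 0 o2 * y 0 o0 * c o2 o0 0 k + x 0 o2 * y 0 o1 * c o2 o1 0 k +
  x 0 o2 * y 0 o2 * c o2 o2 0 k.
Proof.
have s3 (F : 'I_3 -> K) : \sum_i F i = F o0 + F o1 + F o2.
  rewrite !big_ord_recl big_ord0 addr0 addrA.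
  by congr (F _ + F _ + F _); apply: val_inj.
have -> : table_mul c x y 0 k =
    \sum_i \sum_j x 0 i * y 0 j * c i j 0 k.
  rewrite summxE; apply: eq_bigr => i _.
  by rewrite summxE; apply: eq_bigr => j _; rewrite mxE.
by rewrite s3 !s3 !addrA.
Qed.

(* All the tables above have this shape. *)
Definition table_shape (u v p q : K) (c : 'I_3 -> 'I_3 -> 'rV[K]_3) :=
  forall i j, c i j = match i.+1, j.+1 with
    | 1, 1 => (u *: e2 + v *: e3)%R
    | 1, 2 => (p *: e3)%R
    | 2, 1 => (q *: e3)%R
    | _, _ => 0%R
    end%N.

Lemma table_shapeE u v p q c : table_shape u v p q c ->
  [/\ forall x y, table_mul c x y 0 o0 = 0,
      forall x y, table_mul c x y 0 o1 = u * (x 0 o0 * y 0 o0)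
    & forall x y, table_mul c x y 0 o2 = v * (x 0 o0 * y 0 o0)
        + p * (x 0 o0 * y 0 o1) + q * (x 0 o1 * y 0 o0)].
Proof.
move=> cE; split=> x y; rewrite table_mul3E !cE /= !mxE /=.
all: ring.
Qed.

Fact mu30_shape : table_shape 1 0 1 1 mu30_table.
Proof.
move=> [[|[|[|//]]] ?] [[|[|[|//]]] ?] //=.
all: by rewrite ?scale0r ?scale1r ?addr0.
Qed.

Fact AD31_r_shape : table_shape 2^-1 0 2 (-1) AD31_r_table.
Proof.
move=> [[|[|[|//]]] ?] [[|[|[|//]]] ?] //=.
all: by rewrite ?scale0r ?scaleN1r ?addr0.
Qed.

Fact AD31_l_shape : table_shape 2^-1 (- 0) (-1) 2 AD31_l_table.
Proof.
move=> [[|[|[|//]]] ?] [[|[|[|//]]] ?] //=.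
all: by rewrite ?oppr0 ?scale0r ?scaleN1r ?addr0.
Qed.

Fact AD32_r_shape : table_shape 2^-1 1 2 (-1) AD32_r_table.
Proof.
move=> [[|[|[|//]]] ?] [[|[|[|//]]] ?] //=.
all: by rewrite ?scaleN1r ?scale1r.
Qed.

Fact AD32_l_shape : table_shape 2^-1 (- 1) (-1) 2 AD32_l_table.
Proof.
move=> [[|[|[|//]]] ?] [[|[|[|//]]] ?] //=.
all: by rewrite ?scaleN1r.
Qed.

Fact mu30_mulA : associative (table_mul mu30_table).
Proof.
have [m0 m1 m2] := table_shapeE mu30_shape.
by move=> x y z; apply: row3P; rewrite !(m0, m1, m2); ring.
Qed.

Definition mu30 : assocAlg 'rV[K]_3 := AssocAlg mu30_mulA.

Lemma table_shape_antidendriform v r l :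
  table_shape 2^-1 v 2 (-1) r -> table_shape 2^-1 (- v) (-1) 2 l ->
  antidendriform_axiom (table_mul r) (table_mul l).
Proof.
move=> /table_shapeE[r0 r1 r2] /table_shapeE[l0 l1 l2] m x y z.
have m0 a b : m a b 0 o0 = 0 by rewrite mxE r0 l0 addr0.
have m1 a b : m a b 0 o1 = a 0 o0 * b 0 o0 by rewrite mxE r1 l1; field.
have N (a : 'rV[K]_3) k : (- a) 0 k = - a 0 k by rewrite mxE.
by split; apply: row3P; rewrite ?N !(r0, r1, r2, l0, l1, l2, m0, m1); field.
Qed.

Definition AD31 : antiDendriform 'rV[K]_3 :=
  AntiDendriform (table_shape_antidendriform AD31_r_shape AD31_l_shape).

Definition AD32 : antiDendriform 'rV[K]_3 :=
  AntiDendriform (table_shape_antidendriform AD32_r_shape AD32_l_shape).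

End DimensionThree.

(* Main.v *)
Require Import Defs.
From mathcomp Require Import all_boot all_order all_algebra.
From mathcomp Require Import complex.
From mathcomp Require Import reals.
From HB Require Import structures.
From mathcomp Require Import sesquilinear ring.

Set Implicit Arguments.
Unset Strict Implicit.
Unset Printing Implicit Defensive.

Import GRing.Theory Num.Theory.
Local Open Scope ring_scope.

(** Write [r] and [l] for the two operations and [xy] for their sum.  The
    axioms give the mixed identities
      [r x (yz) = l (xy) z],  [l x (yz) = r (xy) z],  [l (r x y) z = (xy)z].
    In [mu_3^0], put [a = e1], [b = e2 = aa] and [c = e3 = ab = ba].  The first
    two identities move a factor [a] across the operations, so that
    [r a c], [r c a], [r b b] and the corresponding [l]-products are all equal;
    as [r b b + l b b = bb = 0], they vanish.  Only [r a a = p a + q b + s c]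
    and [u = r a b] remain free, with [r b a = c - u].  The vanishing of
    [r a u] and [l u a] forces [u] to be a multiple [k c]; then
    [l (r a a) a = c] reads [p (b - r a a) + q u = c], whence [p = 0] and
    [q k = 1], and [r a (r a a) = - r b a] gives [k = 2].  So
    [r a a = b / 2 + s c], [r a b = 2 c], [r b a = - c], and [s] is the only
    parameter ([adr_mu30_basis], [mu30_normal_form]).

    The map [diag(t, t^2, t^3)] multiplies [s] by [t]
    ([normal_form_rescale]), which leaves the cases [s = 0] and [s = 1].
    They are told apart by the identity [r x x = l x x], which holds exactly
    when [s = 0] ([normal_form_square]). *)

(** * Identities in an anti-dendriform algebra *)

Section Identities.
Variables (K : fieldType) (V : lmodType K) (A : antiDendriform V).
Implicit Types x y z : V.

Lemma adl_mulr x y z : adl A x (ad_mul A y z) = adr A (ad_mul A x y) z.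
Proof. by have [_ /oppr_inj] := adP A x y z. Qed.

(** Since [x(yz) = (xy)z], the two splittings of this product into its [r]-
    and [l]-parts have the same sum, and [adl_mulr] cancels one part of each. *)
Lemma adr_mulr x y z : adr A x (ad_mul A y z) = adl A (ad_mul A x y) z.
Proof.
have := ad_mulA A x y z.
by rewrite {1}/ad_mul adl_mulr {2}/ad_mul addrC => /addrI.
Qed.

Lemma adr_adr x y z : adr A x (adr A y z) = - adr A (ad_mul A x y) z.
Proof. by have [] := adP A x y z. Qed.

(** Expand [(xy)z = r (xy) z + l (r x y) z + l (l x y) z]; the axioms say that
    the last term is the opposite of the first. *)
Lemma adl_adr x y z : adl A (adr A x y) z = ad_mul A (ad_mul A x y) z.
Proof.
have [_ h2 h3 _] := adP A x y z.
rewrite /ad_mul (linearDl (adl A)) -h3 -h2 /=.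
by rewrite addrCA subrr addr0.
Qed.

End Identities.

(** * Transport of structure *)

Section Isomorphisms.
Variable K : fieldType.

Lemma antidendriform_iso_trans (U V W : lmodType K) (A : antiDendriform U)
    (B : antiDendriform V) (C : antiDendriform W) :
  antidendriform_iso A B -> antidendriform_iso B C -> antidendriform_iso A C.
Proof.
move=> [f [bf fr fl]] [g [bg gr gl]]; exists (g \o f : {linear U -> W}); split.
- exact: bij_comp bg bf.
- by move=> x y /=; rewrite fr gr.
- by move=> x y /=; rewrite fl gl.
Qed.

Lemma bilinear_transport (V W : lmodType K) (f : {linear V -> W})
    (g : W -> V) (op : {bilinear V -> V -> V}) :
  cancel f g -> cancel g f ->
  exists op' : {bilinear W -> W -> W},
    forall x y, op' x y = f (op (g x) (g y)).
Proof.
move=> fK gK; have g_lin : linear g by exact: can2_linear fK gK.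
have op'_bilin : bilinear_for *:%R *:%R (fun x y => f (op (g x) (g y))).
  split=> u a x y /=.
  - by rewrite g_lin linearPl linearP.
  - by rewrite g_lin linearPr linearP.
pose mixin := bilinear_isBilinear.Build K W W W *:%R *:%R _ op'_bilin.
pose op' : {bilinear W -> W -> W} :=
  HB.pack (fun x y => f (op (g x) (g y))) mixin.
by exists op'.
Qed.

Lemma antidendriform_transport (V W : lmodType K) (A : antiDendriform V)
    (f : {linear V -> W}) :
  bijective f ->
  exists B : antiDendriform W,
    (forall x y, f (adr A x y) = adr B (f x) (f y)) /\
    (forall x y, f (adl A x y) = adl B (f x) (f y)).
Proof.
case=> g fK gK.
have [r rE] := bilinear_transport (adr A) fK gK.
have [l lE] := bilinear_transport (adl A) fK gK.
have B_ax : antidendriform_axiom r l.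
  move=> x y z; have [h1 h2 h3 h4] := adP A (g x) (g y) (g z).
  rewrite !rE !lE -!linearD !fK -!(linearN f).
  by split; congr (f _).
by exists (AntiDendriform B_ax); split=> x y /=; rewrite (rE, lE) !fK.
Qed.

Lemma associated_to_transport (V W : lmodType K) (A : antiDendriform V)
    (M : assocAlg W) :
  associated_to A M ->
  exists2 B : antiDendriform W, antidendriform_iso A B & ad_mul B =2 amul M.
Proof.
case=> f [bf fM]; have [B [fr fl]] := antidendriform_transport A bf.
exists B; first by exists f.
move=> x y; have [g _ gK] := bf.
by rewrite -(gK x) -(gK y) -fM /= /ad_mul linearD fr fl.
Qed.

End Isomorphisms.

(** * Structure constants *)

Section Tables.
Variables (K : fieldType) (n : nat).

Lemma table_mul_delta (c : 'I_n -> 'I_n -> 'rV[K]_n) i j :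
  table_mul c (delta_mx 0 i) (delta_mx 0 j) = c i j.
Proof.
rewrite /table_mul (bigD1 i) //= (bigD1 j) //= !mxE !eqxx mulr1 scale1r.
rewrite big1 => [|k /negPf kj]; last by rewrite !mxE kj mulr0 scale0r.
rewrite big1 ?addr0 // => k /negPf ki; apply: big1 => k' _.
by rewrite !mxE ki mul0r scale0r.
Qed.

Definition structure_constants (op : 'rV[K]_n -> 'rV[K]_n -> 'rV[K]_n)
    (i j : 'I_n) := op (delta_mx 0 i) (delta_mx 0 j).

Lemma bilinear_tableE (op : {bilinear 'rV[K]_n -> 'rV[K]_n -> 'rV[K]_n}) :
  op =2 table_mul (structure_constants op).
Proof.
move=> x y; rewrite {1}(row_sum_delta x) {1}(row_sum_delta y).
rewrite linear_sumlz; apply: eq_bigr => i _.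
rewrite linearZl_LR linear_sumr scaler_sumr; apply: eq_bigr => j _.
by rewrite linearZr_LR scalerA.
Qed.

End Tables.

(** * The one-parameter family of normal forms *)

Section NormalForms.
Variable K : numFieldType.
Implicit Types B C : antiDendriform 'rV[K]_3.

Let o0 := @Ordinal 3 0 isT.
Let o1 := @Ordinal 3 1 isT.
Let o2 := @Ordinal 3 2 isT.

(** The parameter [s] is the coefficient of [e3] in [e1 |> e1]; the other
    structure constants are those shared by [AD_3^1] and [AD_3^2]. *)
Definition normal_form (s : K) (B : antiDendriform 'rV[K]_3) :=
  exists r l, [/\ table_shape 2^-1 s 2 (-1) r,
    table_shape 2^-1 (- s) (-1) 2 l,
    adr B =2 table_mul r & adl B =2 table_mul l].

Lemma AD31_normal_form : normal_form 0 (AD31 K).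
Proof.
exists (@AD31_r_table K), (@AD31_l_table K); split=> //.
- exact: AD31_r_shape.
- exact: AD31_l_shape.
Qed.

Lemma AD32_normal_form : normal_form 1 (AD32 K).
Proof.
exists (@AD32_r_table K), (@AD32_l_table K); split=> //.
- exact: AD32_r_shape.
- exact: AD32_l_shape.
Qed.

Lemma normal_form_associated s B :
  normal_form s B -> associated_to B (mu30 K).
Proof.
case=> r [l [/table_shapeE[r0 r1 r2] /table_shapeE[l0 l1 l2] rE lE]].
have [m0 m1 m2] := table_shapeE (mu30_shape K).
exists (idfun : {linear 'rV[K]_3 -> 'rV[K]_3}); split; first by exists id.
move=> x y /=; rewrite /ad_mul rE lE.
by apply: row3P; rewrite mxE !(r0, r1, r2, l0, l1, l2, m0, m1, m2); field.
Qed.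

(** The third coordinate of [r x x - l x x] is [2 s x_1^2], and the two other
    coordinates vanish. *)
Lemma normal_form_square s B :
  normal_form s B -> (forall x, adr B x x = adl B x x) <-> s = 0.
Proof.
case=> r [l [/table_shapeE[r0 r1 r2] /table_shapeE[l0 l1 l2] rE lE]].
split=> [rl | s0 x]; last first.
  by rewrite rE lE; apply: row3P; rewrite !(r0, r1, r2, l0, l1, l2) ?s0; ring.
have := congr1 (fun u : 'rV[K]_3 => u 0 o2) (rl (e1 K)).
rewrite rE lE r2 l2 !mxE /= !mulr0 !mul0r !mulr0 !addr0 !mulr1 => /eqP.
rewrite -subr_eq0 opprK -mulr2n mulrn_eq0 /= => /eqP //.
Qed.

Lemma normal_form_iso_eq0 s t B C :
  normal_form s B -> normal_form t C -> antidendriform_iso B C ->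
  s = 0 -> t = 0.
Proof.
move=> nfB nfC [f [[g _ gK] fr fl]] s0; apply/(normal_form_square nfC) => x.
by rewrite -(gK x) -fr -fl; congr (f _); move: s0 => /(normal_form_square nfB).
Qed.

(** The map [diag(t, t^2, t^3)] respects the grading of [mu_3^0] in which
    [e_i] has degree [i].  The only inhomogeneous term of the operations is
    [s e3] in [e1 |> e1] and [e1 <| e1], off by one degree. *)
Lemma normal_form_rescale s t B C :
  t != 0 -> normal_form s B -> normal_form (t * s) C -> antidendriform_iso B C.
Proof.
move=> t0 [r [l [/table_shapeE[r0 r1 r2] /table_shapeE[l0 l1 l2] rE lE]]].
move=> [r' [l' [/table_shapeE[r0' r1' r2'] /table_shapeE[l0' l1' l2']]]] rE' lE'.
pose d (u : K) : 'rV[K]_3 := \row_i u ^+ i.+1.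
pose f u : {linear 'rV[K]_3 -> 'rV[K]_3} := mulmxr (diag_mx (d u)).
have fE u x i : f u x 0 i = x 0 i * u ^+ i.+1.
  by rewrite /f /= mul_mx_diag !mxE.
have fK u v : u * v = 1 -> cancel (f u) (f v).
  by move=> uv x; apply/rowP => i; rewrite !fE -mulrA -exprMn uv expr1n mulr1.
exists (f t); split.
- by exists (f t^-1); apply: fK; rewrite ?mulfV ?mulVf.
- move=> x y; rewrite rE rE'.
  by apply: row3P; rewrite fE !(r0, r1, r2, r0', r1', r2') ?fE /=; ring.
- move=> x y; rewrite lE lE'.
  by apply: row3P; rewrite fE !(l0, l1, l2, l0', l1', l2') ?fE /=; ring.
Qed.

(** * Anti-dendriform structures with the product of mu_3^0 *)

Section Classification.
Variable B : antiDendriform 'rV[K]_3.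
Hypothesis B_mul : ad_mul B =2 table_mul (@mu30_table K).

Local Notation a := (e1 K).
Local Notation b := (e2 K).
Local Notation c := (e3 K).
Local Notation r := (adr B).
Local Notation l := (adl B).
Local Notation m := (ad_mul B).

Let mE i j : m (delta_mx 0 i) (delta_mx 0 j) = mu30_table K i j.
Proof. by rewrite B_mul table_mul_delta. Qed.

Let maa : m a a = b. Proof. exact: mE. Qed.
Let mab : m a b = c. Proof. exact: mE. Qed.
Let mba : m b a = c. Proof. exact: mE. Qed.
Let mac : m a c = 0. Proof. exact: mE. Qed.
Let mbb : m b b = 0. Proof. exact: mE. Qed.
Let mbc : m b c = 0. Proof. exact: mE. Qed.
Let mca : m c a = 0. Proof. exact: mE. Qed.

Let adlE x y : l x y = m x y - r x y.
Proof. by rewrite /ad_mul addrC addKr. Qed.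

Let row3E (x : 'rV[K]_3) : x = x 0 o0 *: a + x 0 o1 *: b + x 0 o2 *: c.
Proof. by apply: row3P; rewrite !mxE /=; ring. Qed.

(** All bracketings [x (yz)] and [(xy) z] of the word [aaaa] are linked by
    [adr_mulr] and [adl_mulr], so the six products [r] and [l] of the pairs
    [(a, c)], [(b, b)], [(c, a)] coincide; since [bb = 0], twice this common
    value is zero. *)
Lemma adr_degree4 : [/\ r a c = 0, r b b = 0 & r c a = 0].
Proof.
have ac_bb : r a c = l b b by rewrite -mab adr_mulr maa.
have ac_ca : r a c = l c a by rewrite -{1}mba adr_mulr mab.
have ca_bb : r c a = l b b by rewrite -{1}mba -adl_mulr maa.
have bb_ac : r b b = l a c by rewrite -{1}maa -adl_mulr mab.
have ca_ac : r c a = l a c by rewrite -{1}mab -adl_mulr mba.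
have bb0 : r b b = 0.
  have : m b b = r b b *+ 2.
    by rewrite /ad_mul mulr2n -ca_bb ca_ac -bb_ac.
  by rewrite mbb -scaler_nat => /esym/eqP; rewrite scaler_eq0 pnatr_eq0 => /eqP.
by rewrite ac_bb -ca_bb ca_ac -bb_ac bb0.
Qed.

(** Each product equals an [l]-product one of whose factors is [ac], [bb] or
    [bc], all zero in [mu_3^0]. *)
Lemma adr_degree5 : [/\ r b c = 0, r c b = 0 & r c c = 0].
Proof.
split.
- by rewrite -{1}maa -adl_mulr mac linear0r.
- by rewrite -{1}mab -adl_mulr mbb linear0r.
- by rewrite -{1}mab -adl_mulr mbc linear0r.
Qed.

Lemma adr_mu30_basis : exists s,
  [/\ r a a = 2^-1 *: b + s *: c, r a b = 2 *: c & r b a = - c].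
Proof.
have [ac0 bb0 ca0] := adr_degree4.
set u := r a b.
have lbaE : l b a = u by rewrite -maa -adr_mulr maa.
have rbaE : r b a = c - u by rewrite -lbaE adlE mba opprB addrC subrK.
have rau : r a u = 0 by rewrite /u adr_adr maa bb0 oppr0.
have lua : l u a = 0 by rewrite /u adl_adr mab mca.
have raa2 : r a (r a a) = u - c by rewrite adr_adr maa rbaE opprB.
have laa2 : l (r a a) a = c by rewrite adl_adr maa mba.
have lca0 : l c a = 0 by rewrite adlE mca ca0 subr0.
have laaE : l a a = b - r a a by rewrite adlE maa.
have raE x : r a x = x 0 o0 *: r a a + x 0 o1 *: u.
  rewrite {1}(row3E x) !linearDr !linearZr_LR /=.
  by rewrite ac0 scaler0 addr0.
have laE x : l x a = x 0 o0 *: (b - r a a) + x 0 o1 *: u.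
  rewrite {1}(row3E x) !linearDl !linearZl_LR /=.
  by rewrite laaE lbaE lca0 scaler0 addr0.
have two0 : (2 : K) != 0 by rewrite pnatr_eq0.
(* This is [r a u + l u a = 0]: in the sum, the unknown [r a a] cancels. *)
have u_eq : u 0 o0 *: b + (2 * u 0 o1) *: u = 0.
  rewrite -[RHS]addr0 -{1}rau -lua raE laE addrACA -scalerDr.
  by rewrite [r a a + _]addrC subrK -scalerDl mulr_natl.
have u1 : u 0 o1 = 0.
  have /rowP h := u_eq.
  have := h o0; rewrite !mxE /= => h0.
  have := h o1; rewrite !mxE /= => h1.
  (* The coordinates on [a] and [b] of [u_eq], for [u = x a + y b + k c], are
     [2 y x = 0] and [x + 2 y^2 = 0]; hence [4 y^3 = 0]. *)
  have : u 0 o1 ^+ 3 = 0.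
    have -> : u 0 o1 ^+ 3 = 2^-1 * 2^-1 *
        (2 * u 0 o1 * (u 0 o0 * 1 + 2 * u 0 o1 * u 0 o1)
         - (u 0 o0 * 0 + 2 * u 0 o1 * u 0 o0)) by field.
    by rewrite h0 h1 mulr0 subr0 mulr0.
  by move/eqP; rewrite expf_eq0 => /eqP.
have u0 : u 0 o0 = 0.
  have /rowP/(_ o1) := u_eq.
  by rewrite u1 !mxE /= mulr0 mul0r addr0 mulr1.
have uE : u = u 0 o2 *: c.
  by rewrite {1}(row3E u) u0 u1 !scale0r !add0r.
set k := u 0 o2 in uE.
set w := r a a in laa2 raa2 laE raE *.
have w0 : w 0 o0 = 0.
  have /rowP/(_ o0) := laa2; rewrite laE uE !mxE /=.
  rewrite sub0r !mulr0 addr0 mulrN -expr2 => /eqP.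
  by rewrite oppr_eq0 expf_eq0 => /eqP.
have qk : w 0 o1 * k = 1.
  have /rowP/(_ o2) := laa2; rewrite laE w0 uE !mxE /=.
  by rewrite mul0r add0r !mulr1.
have k2 : k = 2.
  have /rowP/(_ o2) := raa2; rewrite raE w0 uE !mxE /=.
  rewrite mul0r add0r !mulr1 qk => h.
  by rewrite -(subrK 1 k) -h.
exists (w 0 o2); split.
- rewrite {1}(row3E w) w0 scale0r add0r.
  by congr (_ *: _ + _); rewrite -[LHS](mulfK two0) -k2 qk mul1r k2.
- by rewrite uE k2.
- by rewrite rbaE uE k2 scaler_nat mulr2n opprD addrA subrr sub0r.
Qed.

Lemma adr_mu30_shape s :
  r a a = 2^-1 *: b + s *: c -> r a b = 2 *: c -> r b a = - c ->
  table_shape 2^-1 s 2 (-1) (structure_constants r).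
Proof.
have [ac0 bb0 ca0] := adr_degree4; have [bc0 cb0 cc0] := adr_degree5.
move=> aaE abE baE [[|[|[|//]]] hi] [[|[|[|//]]] hj] /=;
  rewrite /structure_constants;
  by rewrite (bool_irrelevance hi isT) (bool_irrelevance hj isT) ?scaleN1r.
Qed.

Lemma adl_mu30_shape s :
  table_shape 2^-1 s 2 (-1) (structure_constants r) ->
  table_shape 2^-1 (- s) (-1) 2 (structure_constants l).
Proof.
move=> r_shape i j.
rewrite /structure_constants adlE mE -/(structure_constants r i j).
rewrite r_shape mu30_shape.
case: i j => [[|[|[|//]]] hi] [[|[|[|//]]] hj] /=; rewrite ?subr0 //.
- by rewrite opprD addrACA -!scalerBl sub0r; congr (_ *: _ + _); field.
- by rewrite -scalerBl; congr (_ *: _); ring.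
- by rewrite -scalerBl; congr (_ *: _); ring.
Qed.

Lemma mu30_normal_form : exists s, normal_form s B.
Proof.
have [s [aaE abE baE]] := adr_mu30_basis.
have r_shape := adr_mu30_shape aaE abE baE.
exists s, (structure_constants r), (structure_constants l); split.
- exact: r_shape.
- exact: adl_mu30_shape r_shape.
- exact: bilinear_tableE.
- exact: bilinear_tableE.
Qed.

End Classification.

End NormalForms.

Theorem corollary3p2 (R : realType) :
  [/\ associated_to (AD31 R[i]) (mu30 R[i]),
      associated_to (AD32 R[i]) (mu30 R[i]),
      ~ antidendriform_iso (AD31 R[i]) (AD32 R[i])
    & forall (V : vectType R[i]) (A : antiDendriform V),
        \dim {:V} = 3%N ->
        associated_to A (mu30 R[i]) ->
        antidendriform_iso A (AD31 R[i]) \/ antidendriform_iso A (AD32 R[i])].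
Proof.
have nf1 := @AD31_normal_form R[i]; have nf2 := @AD32_normal_form R[i].
split.
- exact: normal_form_associated nf1.
- exact: normal_form_associated nf2.
- move=> /(normal_form_iso_eq0 nf1 nf2) /(_ erefl) /eqP.
  by rewrite oner_eq0.
move=> V A _ /associated_to_transport[B AB Bm].
have [s nfB] := mu30_normal_form Bm.
have [s0 | s0] := eqVneq s 0; [left | right].
  apply: antidendriform_iso_trans AB _.
  apply: (normal_form_rescale (t := 1) _ nfB); first exact: oner_neq0.
  by rewrite s0 mulr0; exact: nf1.
apply: antidendriform_iso_trans AB _.
apply: (normal_form_rescale (t := s^-1) _ nfB); first by rewrite invr_eq0.
by rewrite mulVf //; exact: nf2.
Qed.
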